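(* Let $\mathsf{W}$ be a finite Coxeter group with canonical generating set $S=\{s_0,\dots,s_{d-1}\}$, and let $T$ be the set of all elements of $\mathsf{W}$ that are conjugate in $\mathsf{W}$ to an element of $S$. Then the Cayley graph $Cay(\mathsf{W},S)$ is isometrically embeddable into the hypercube graph $H_{|T|}$.
   Context: A Coxeter group is a group $\mathsf{W}$ generated by a set $S=\{s_0,\dots,s_{d-1}\}$ (the canonical generating set), with defining relations $s_i^2=1$ and $(s_is_j)^{m_{ij}}=1$ for $i\neq j$, where $m_{ij}\ge 2$ (that is, $(\mathsf{W},S)$ is a Coxeter system). The Cayley graph $Cay(\mathsf{W},S)$ has vertex set $\mathsf{W}$, with $w$ adjacent to $ws$ for all $w\in \mathsf{W}$, $s\in S$. The hypercube graph $H_m$ has vertex set $\{0,1\}^m$, two vertices being adjacent when they differ in exactly one coordinate. A graph $\Gamma$ with path metric $d_\Gamma$ is isometrically embeddable in a graph $\Gamma'$ if there is a map $\phi$ from the vertices of $\Gamma$ to those of $\Gamma'$ with $d_{\Gamma'}(\phi(u),\phi(v))=d_\Gamma(u,v)$ for all vertices $u,v$ of $\Gamma$. *)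

(* Defs.v *)
From mathcomp Require Import all_boot all_fingroup.

Set Implicit Arguments.
Unset Strict Implicit.
Unset Printing Implicit Defensive.

Local Open Scope group_scope.

(* A word in the letters x_i and x_i^-1; (i, true) stands for x_i and         *)
(* (i, false) for x_i^-1.                                                     *)
Definition word (I : Type) := seq (I * bool).

Definition eval_word (I : Type) (gT : finGroupType) (s : I -> gT)
    (w : word I) : gT :=
  \prod_(x <- w) (if x.2 then s x.1 else (s x.1)^-1).

(* The quotient of the words by [presEq R] is the group with generators I and *)
(* relators R: free reduction yields the free group on I, and inserting or    *)
(* deleting relators yields its quotient by the normal closure of R.          *)
Inductive presEq (I : Type) (R : word I -> Prop) : word I -> word I -> Prop :=
| PresRefl u : presEq R u u
| PresSym u v : presEq R u v -> presEq R v u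
| PresTrans u v w : presEq R u v -> presEq R v w -> presEq R u w
| PresCancel u i b v : presEq R (u ++ [:: (i, b); (i, ~~ b)] ++ v) (u ++ v)
| PresRelator u r v : R r -> presEq R (u ++ r ++ v) (u ++ v).

(* The finGroupType gT is the abstract group <I | R>, with s i the image of   *)
(* the generator i. Unlike [G \isog Grp (...)], this allows a variable number *)
(* of generators and does not only test against finite groups.                *)
Definition presentation (I : Type) (gT : finGroupType) (s : I -> gT)
    (R : word I -> Prop) : Prop :=
  (forall g : gT, exists w : word I, eval_word s w = g) /\
  (forall u v : word I, eval_word s u = eval_word s v <-> presEq R u v).

Inductive coxeter_relator (d : nat) (m : 'I_d -> 'I_d -> nat) :
    word 'I_d -> Prop :=
| CoxSquare i : coxeter_relator m [:: (i, true); (i, true)]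
| CoxBraid i j : i != j ->
    coxeter_relator m (flatten (nseq (m i j) [:: (i, true); (j, true)])).

(* Diagonal values of m are irrelevant. All m i j are finite, as they must be *)
(* when the group is finite; injectivity of s is a consequence.               *)
Record coxeter_system (d : nat) (m : 'I_d -> 'I_d -> nat)
    (gT : finGroupType) (s : 'I_d -> gT) : Prop := CoxeterSystem {
  coxeter_sym : forall i j, i != j -> m i j = m j i;
  coxeter_ge2 : forall i j, i != j -> 2 <= m i j;
  coxeter_pres : presentation s (coxeter_relator m)
}.

Definition generators (d : nat) (gT : finGroupType) (s : 'I_d -> gT) :
  {set gT} := [set s i | i : 'I_d].

Definition reflections (gT : finGroupType) (S : {set gT}) : {set gT} :=
  class_support S [set: gT].

Definition cayley (gT : finGroupType) (S : {set gT}) : rel gT :=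
  fun u v => [exists s in S, (v == u * s) || (u == v * s)].

Definition hypercube (m : nat) : rel {ffun 'I_m -> bool} :=
  fun x y => #|[set i | x i != y i]| == 1%N.

(* n is the path metric distance from x to y in the graph e; no n qualifies   *)
(* when y is not reachable from x (infinite distance).                        *)
Definition graph_dist (V : finType) (e : rel V) (x y : V) (n : nat) : Prop :=
  (exists p : seq V, [/\ path e x p, last x p = y & size p = n]) /\
  (forall p : seq V, path e x p -> last x p = y -> n <= size p).

Definition isometrically_embeddable (V V' : finType) (e : rel V) (e' : rel V') :
    Prop :=
  exists phi : V -> V', forall (u v : V) (n : nat),
    graph_dist e' (phi u) (phi v) n <-> graph_dist e u v n.

(* Main.v *)
Require Import Defs.
From mathcomp Require Import all_boot all_fingroup.

(** A word x_1 ... x_k in the generators crosses the reflections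
    t_j = (x_1 ... x_(j-1)) x_j (x_1 ... x_(j-1))^-1, the walls met by the
    gallery that the word describes in the Coxeter complex.  The parity of the
    number of times a given t occurs among the t_j is not changed by inserting
    or deleting a relator ([crossing_presEq]): the word (s_i s_j)^m lists each
    reflection an even number of times, because it runs twice through the same
    sequence of m reflections.  So the set N(g) of the reflections crossed an
    odd number of times depends only on the element g spelled by the word, and
    the cocycle rule
      t \in N(g h)  iff  exactly one of  t \in N(g),  t ^ g \in N(h)  holds
    ([in_inversions_mul]) shows that the symmetric difference of N(u) and N(v)
    is conjugate to N(u^-1 v).

    The embedding sends w to the indicator function of N(w), a subset of T.
    Each generator s has N(s) = {s}, so adjacent elements go to adjacent
    vertices and distances do not grow.  They do not shrink either, because
    u^-1 v is spelled by a word with only #|N(u^-1 v)| letters: a word spelling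
    an element w can be built letter by letter from the right, and whenever a
    new letter s lies in N of the current element, the exchange condition
    ([exchange]) deletes a letter of the current word instead of adding one
    ([short_word]). *)

Set Implicit Arguments.
Unset Strict Implicit.
Unset Printing Implicit Defensive.

Local Open Scope group_scope.

(** * Path metrics and the hypercube *)

Lemma graph_dist_eq (V : finType) (e : rel V) (x y : V) (k : nat) :
  graph_dist e x y k -> forall n, graph_dist e x y n <-> n = k.
Proof.
move=> dk n; split=> [dn | -> //].
case: dk dn => -[p [ep lp <-]] mink [[q [eq lq <-]] minn].
by apply/eqP; rewrite eqn_leq minn // mink.
Qed.

Section Hamming.

Variable m : nat.
Implicit Types x y z : {ffun 'I_m -> bool}.

Definition hamming x y := #|[set i | x i != y i]|.

Lemma hamming0 x y : hamming x y = 0 -> x = y.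
Proof.
move/eqP; rewrite cards_eq0 => /eqP xy0; apply/ffunP => i.
by apply/eqP; move/setP/(_ i): xy0; rewrite !inE => /negbFE.
Qed.

Lemma hamming_triangle x y z : hamming x z <= hamming x y + hamming y z.
Proof.
apply: leq_trans (leq_card_setU _ _); apply/subset_leq_card/subsetP => i.
by rewrite !inE; case: (x i); case: (y i); case: (z i).
Qed.

Lemma hamming_le_path x p :
  path (@hypercube m) x p -> hamming x (last x p) <= size p.
Proof.
elim: p x => [|y p IHp] x /=.
  by move=> _; rewrite leqn0 cards_eq0; apply/eqP/setP => i; rewrite !inE eqxx.
case/andP=> /eqP xy /IHp le_p.
by apply: leq_trans (hamming_triangle x y _) _; rewrite {1}/hamming xy.
Qed.

Lemma hypercube_path x y :
  exists p, [/\ path (@hypercube m) x p, last x p = y & size p = hamming x y].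
Proof.
move: {2}(hamming x y) (erefl (hamming x y)) => n.
elim: n x => [|n IHn] x dxy; first by exists [::]; rewrite dxy (hamming0 dxy).
have /card_gt0P[i]: 0 < hamming x y by rewrite dxy.
rewrite inE => xyi.
pose z := [ffun j => if j == i then y i else x j].
have xz : hypercube x z.
  rewrite /hypercube (_ : [set j | _] = [set i]) ?cards1 //.
  by apply/setP=> j; rewrite !inE ffunE; case: (eqVneq j i) => [-> | _] //;
    rewrite eqxx.
have zy : hamming z y = n.
  apply/eqP; rewrite -eqSS -dxy /hamming.
  rewrite (cardsD1 i [set j | x j != y j]) inE xyi add1n eqSS.
  apply/eqP/eq_card => j; rewrite !inE ffunE.
  by case: (eqVneq j i) => [-> | _] //=; rewrite eqxx.
have [p [zp lp sp]] := IHn z zy.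
by exists (z :: p); rewrite /= xz zp lp sp zy dxy.
Qed.

Lemma hypercube_dist x y : graph_dist (@hypercube m) x y (hamming x y).
Proof.
split=> [|p xp <-]; [exact: hypercube_path | exact: hamming_le_path].
Qed.

(** Edge preservation gives one inequality between the two metrics, so that
    only one path needs to be found for each pair of vertices. *)
Lemma hypercube_embedding (V : finType) (e : rel V)
    (phi : V -> {ffun 'I_m -> bool}) :
    (forall u v, e u v -> hypercube (phi u) (phi v)) ->
    (forall u v, exists p,
       [/\ path e u p, last u p = v & size p = hamming (phi u) (phi v)]) ->
  isometrically_embeddable e (@hypercube m).
Proof.
move=> phi_e phi_path; exists phi => u v n.
have duv : graph_dist e u v (hamming (phi u) (phi v)).
  split=> // p up <-; rewrite -(size_map phi) -last_map.
  by apply: hamming_le_path; rewrite path_map; apply: sub_path up => ? ? /phi_e.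
split=> [/(graph_dist_eq (hypercube_dist _ _)) -> | /(graph_dist_eq duv) ->] //.
exact: hypercube_dist.
Qed.

End Hamming.

(** * Reflections crossed by a word *)

Section Crossings.

Variables (d : nat) (W : finGroupType) (s : 'I_d -> W).
Implicit Types (t : W) (u v w : word 'I_d).

Definition letter (x : 'I_d * bool) : W := if x.2 then s x.1 else (s x.1)^-1.

Lemma eval_nil : eval_word s [::] = 1.
Proof. by rewrite /eval_word big_nil. Qed.

Lemma eval_cons x w : eval_word s (x :: w) = letter x * eval_word s w.
Proof. by rewrite /eval_word big_cons. Qed.

Lemma eval_cat u v : eval_word s (u ++ v) = eval_word s u * eval_word s v.
Proof. by rewrite /eval_word big_cat. Qed.

Lemma eval_rotation i j n :
  eval_word s (flatten (nseq n [:: (i, true); (j, true)])) = (s i * s j) ^+ n.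
Proof.
elim: n => [|n IHn] /=; first exact: eval_nil.
by rewrite !eval_cons IHn mulgA expgS.
Qed.

(** The parity of the number of times that w crosses t.  After the letter x,
    the rest of the word is read from the chamber of x, and t has become its
    conjugate by x. *)
Fixpoint crossing w t : bool :=
  if w is x :: w' then (t == s x.1) (+) crossing w' (t ^ letter x) else false.

Lemma crossing_cat u v t :
  crossing (u ++ v) t = crossing u t (+) crossing v (t ^ eval_word s u).
Proof.
elim: u t => [|x u IHu] t /=; first by rewrite eval_nil conjg1.
by rewrite IHu addbA eval_cons conjgM.
Qed.

Lemma crossing_reflection w t :
  crossing w t -> t \in reflections (generators s).
Proof.
elim: w t => //= x w IHw t; case: eqP => [-> _ | _ /IHw].
  by rewrite mem_class_support ?imset_f.
rewrite /reflections -{1}(class_supportGidr _ (in_setT (letter x))).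
by rewrite memJ_conjg.
Qed.

Hypothesis invol : forall i, s i * s i = 1.

Lemma gen_inv i : (s i)^-1 = s i.
Proof. by apply/eqP; rewrite eq_invg_mul invol. Qed.

Lemma letterE x : letter x = s x.1.
Proof. by rewrite /letter gen_inv if_same. Qed.

Lemma eq_genJ i t : (t ^ s i == s i) = (t == s i).
Proof.
by rewrite (can2_eq (conjgK _) (conjgKV _)) conjgE invgK mulgA mulgK.
Qed.

(** If w crosses t an odd number of times then it crosses t at all, and
    multiplying by t on the left deletes the letter where it does. *)
Lemma exchange w t : crossing w t ->
  exists w', eval_word s w' = t * eval_word s w /\ size w = (size w').+1.
Proof.
elim: w t => //= x w IHw t; case: eqP => [-> _ | _ /IHw[w' [ew' sw']]].
  by exists w; rewrite eval_cons letterE mulgA invol mul1g.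
by exists (x :: w'); rewrite !eval_cons ew' sw' mulgA -conjgC mulgA.
Qed.

(** Listing the crossed reflections by the powers of the rotation s_i s_j makes
    their periodicity visible: when (s_i s_j)^n = 1, the indices l and l + n
    give the same reflection and the two halves of the sum cancel. *)
Lemma crossing_dihedral i j n t :
  crossing (flatten (nseq n [:: (i, true); (j, true)])) t
    = \big[addb/false]_(l < n.*2) (t == (s i * s j) ^+ l * s i).
Proof.
elim: n => [|n IHn]; first by rewrite big_ord0.
rewrite -addn1 nseqD flatten_cat crossing_cat IHn eval_rotation.
rewrite /= /letter /= addbF.
rewrite addn1 doubleS !big_ord_recr /= -addbA.
set c := s i * s j.
(* Conjugation by s_i inverts the rotation c, as in any dihedral group. *)
have ac : c ^+ n * s i = s i * (c ^+ n)^-1.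
  rewrite conjgC conjXg -expgVn; congr (_ * _ ^+ n).
  by rewrite conjgE gen_inv invMg !gen_inv !mulgA invol mul1g.
have conj_eq (x y z : W) : (x ^ y == z) = (x == z ^ y^-1)
  by rewrite (can2_eq (conjgK y) (conjgKV y)).
have conj_i : s i ^ (c ^+ n)^-1 = c ^+ n.*2 * s i.
  by rewrite conjgE invgK -addnn expgD -[RHS]mulgA; congr (_ * _).
have conj_c : c ^ (c ^+ n)^-1 = c.
  by rewrite conjgE (commuteV (commuteX n (commute_refl c))) mulKg.
have conj_j : s j ^ (s i)^-1 = c * s i by rewrite conjgE invgK gen_inv mulgA.
by rewrite !conj_eq conj_j conjMg conj_c conj_i mulgA -expgS.
Qed.

Lemma crossing_relator m w t :
    (forall i j, i != j -> (s i * s j) ^+ m i j = 1) ->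
  coxeter_relator m w -> crossing w t = false.
Proof.
move=> braid [i | i j /braid cm] /=.
  by rewrite addbF /letter /= eq_genJ addbb.
rewrite crossing_dihedral -addnn big_split_ord /=.
set b := \big[_/_]_(l < _) _; rewrite (_ : \big[_/_]_(l < _) _ = b) ?addbb //.
by apply: eq_bigr => l _; rewrite expgD cm mul1g.
Qed.

(** A subword that evaluates to 1 leaves the later crossings in place, and a
    relator or a cancelling pair crosses each t an even number of times itself,
    so that removing it changes no parity. *)
Lemma crossing_presEq m u v :
    (forall i j, i != j -> (s i * s j) ^+ m i j = 1) ->
    (forall w, coxeter_relator m w -> eval_word s w = 1) ->
  presEq (coxeter_relator m) u v -> crossing u =1 crossing v.
Proof.
move=> braid eval1.
elim {u v} => // [u v _ uv | u v w _ uv _ vw | u i b v | u r v rel] t.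
- by rewrite uv.
- by rewrite uv vw.
- rewrite crossing_cat [RHS]crossing_cat /= !letterE /= eq_genJ addKb.
  by rewrite -[(_ ^ s i) ^ s i]conjgM invol conjg1.
- by rewrite !crossing_cat (crossing_relator _ braid rel) (eval1 r rel) conjg1.
Qed.

End Crossings.

(** * The inversion set of an element of a Coxeter group *)

Section Inversions.

Variables (d : nat) (m : 'I_d -> 'I_d -> nat) (W : finGroupType).
Variables (s : 'I_d -> W) (hW : coxeter_system m s).
Implicit Types (g h t u v : W).

Lemma eval_relator w : coxeter_relator m w -> eval_word s w = 1.
Proof.
case: hW => _ _ [_ eval_pres] rel.
rewrite -(eval_nil s); apply: (proj2 (eval_pres _ _)).
by have := PresRelator [::] [::] rel; rewrite cats0.
Qed.

Lemma gen_invol i : s i * s i = 1.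
Proof.
by have := eval_relator (CoxSquare m i); rewrite !eval_cons eval_nil mulg1.
Qed.

Lemma gen_braid i j : i != j -> (s i * s j) ^+ m i j = 1.
Proof.
by move=> ij; rewrite -eval_rotation; exact: eval_relator (CoxBraid m ij).
Qed.

Lemma crossing_eval (v w : word 'I_d) :
  eval_word s v = eval_word s w -> crossing s v =1 crossing s w.
Proof.
case: hW => _ _ [_ eval_pres] /eval_pres.
exact: (crossing_presEq gen_invol gen_braid eval_relator).
Qed.

Lemma has_spelling g : exists w : word 'I_d, eval_word s w == g.
Proof. by case: hW => _ _ [/(_ g)[w <-] _]; exists w. Qed.

(** The choice of the spelling of g is immaterial, by [crossing_eval]. *)
Definition inversions g := [set t | crossing s (xchoose (has_spelling g)) t].

Lemma in_inversions w t : (t \in inversions (eval_word s w)) = crossing s w t.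
Proof.
by rewrite inE; apply/crossing_eval/eqP/(xchooseP (has_spelling _)).
Qed.

Lemma in_inversions_mul g h t :
  (t \in inversions (g * h))
    = (t \in inversions g) (+) (t ^ g \in inversions h).
Proof.
have [v /eqP <-] := has_spelling g; have [w /eqP <-] := has_spelling h.
by rewrite -eval_cat !in_inversions crossing_cat.
Qed.

Lemma inversions_gen i : inversions (s i) = [set s i].
Proof.
apply/setP=> t; rewrite inE.
have si : eval_word s [:: (i, true)] = s i by rewrite eval_cons eval_nil mulg1.
by rewrite -[X in inversions X]si in_inversions /= addbF.
Qed.

Lemma inversions_reflection g : inversions g \subset reflections (generators s).
Proof. by apply/subsetP=> t; rewrite inE => /crossing_reflection. Qed.

(** N(s g) is the conjugate of N(g) by s with s itself toggled, so prefixing s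
    lengthens the word by one letter exactly when s is not yet in N(g). *)
Lemma short_word g : exists w, eval_word s w = g /\ size w = #|inversions g|.
Proof.
have [v /eqP <-] := has_spelling g; elim: v => [|x v [w []]].
  exists [::]; split=> //; apply/esym/eqP; rewrite cards_eq0.
  by apply/eqP/setP=> t; rewrite in_inversions inE.
rewrite eval_cons (letterE gen_invol) => <-.
set i := x.1; set h := eval_word s w => sw.
have toggle : inversions (s i * h) :\ s i = (inversions h :\ s i) :^ s i.
  apply/setP=> t; rewrite mem_conjg (gen_inv gen_invol) !in_setD1.
  rewrite eq_genJ in_inversions_mul inversions_gen inE.
  by case: (t == s i).
have cardD : #|inversions (s i * h) :\ s i| = #|inversions h :\ s i|.
  by rewrite toggle cardJg.
have si_in : (s i \in inversions (s i * h)) = (s i \notin inversions h).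
  by rewrite in_inversions_mul inversions_gen set11 conjgE mulKg.
case: (boolP (s i \in inversions h)) => hi.
  have [|w' [ew' sw']] := exchange gen_invol (w := w) (t := s i).
    by rewrite -in_inversions.
  exists w'; split=> //; apply/eqP; rewrite -eqSS -sw' sw (cardsD1 (s i)) hi.
  by rewrite -cardD (cardsD1 (s i) (inversions _)) si_in hi.
exists ((i, true) :: w); split; first by rewrite eval_cons.
rewrite /= sw (cardsD1 (s i) (inversions h)) (negPf hi) -cardD.
by rewrite (cardsD1 (s i) (inversions (_ * _))) si_in hi.
Qed.

Lemma cayley_word_path w u :
  exists p, [/\ path (cayley (generators s)) u p,
                last u p = u * eval_word s w & size p = size w].
Proof.
elim: w u => [|x w IHw] u; first by exists [::]; rewrite eval_nil mulg1.
have [p [up lp sp]] := IHw (u * s x.1).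
exists (u * s x.1 :: p).
rewrite /= up lp sp eval_cons (letterE gen_invol) mulgA andbT; split=> //.
by apply/exists_inP; exists (s x.1); rewrite ?eqxx ?imset_f.
Qed.

Definition inversion_vector g :
    {ffun 'I_#|reflections (generators s)| -> bool} :=
  [ffun k => enum_val k \in inversions g].

(** By the cocycle rule for v = u (u^-1 v), the vectors of u and v differ at t
    exactly when t ^ u is in N(u^-1 v). *)
Lemma hamming_inversion_vector u v :
  hamming (inversion_vector u) (inversion_vector v) = #|inversions (u^-1 * v)|.
Proof.
rewrite /hamming -[RHS](cardJg _ u^-1) -[LHS](card_imset _ enum_val_inj).
apply/eq_card=> t.
have diff : (t \in inversions (u^-1 * v) :^ u^-1)
    = (t \in inversions u) (+) (t \in inversions v).
  by rewrite -{2}(mulKVg u v) in_inversions_mul addKb mem_conjgV.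
rewrite diff; apply/imsetP/idP => [[k kd ->] | td].
  by move: kd; rewrite inE !ffunE; do 2!case: (_ \in _).
have tT : t \in reflections (generators s).
  have [tu | tv] : t \in inversions u \/ t \in inversions v.
  - by move: td; case: (t \in inversions u); [left | right].
  - exact: (subsetP (inversions_reflection u)).
  - exact: (subsetP (inversions_reflection v)).
exists (enum_rank_in tT t); last by rewrite enum_rankK_in.
by rewrite inE !ffunE enum_rankK_in //; move: td; do 2!case: (_ \in _).
Qed.

Lemma inversion_vector_edge u v : cayley (generators s) u v ->
  hypercube (inversion_vector u) (inversion_vector v).
Proof.
rewrite /hypercube -/(hamming _ _) hamming_inversion_vector.
case/exists_inP=> _ /imsetP[i _ ->] vu.
suff -> : u^-1 * v = s i by rewrite inversions_gen cards1.
case/orP: vu => /eqP ->; first by rewrite mulKg.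
by rewrite invMg mulgKV (gen_inv gen_invol).
Qed.

End Inversions.

Theorem proposition1 (W : finGroupType) (d : nat) (m : 'I_d -> 'I_d -> nat)
    (s : 'I_d -> W) (hW : coxeter_system m s) :
  isometrically_embeddable (cayley (generators s))
    (@hypercube #|reflections (generators s)|).
Proof.
apply: (@hypercube_embedding _ _ _ (inversion_vector hW)) => u v.
  exact: inversion_vector_edge.
have [w [ew sw]] := short_word hW (u^-1 * v).
have [p [up lp sp]] := cayley_word_path hW w u.
by exists p; rewrite hamming_inversion_vector up lp sp ew mulKVg.
Qed.
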